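(* The transforms $\mathcal G$ and $\mathcal R$ are inverse to each other, in the following sense. (i) Let $f:(0,\infty)\to\mathbb R$ be piecewise continuous and of exponential order $r$, where $r>0$, let $s>2r$, and let $\varphi_n(s)=\frac1{n!}\int_0^\infty e^{-st}t^nf(t)\,dt$ for $n\in\mathbb N\cup\{0\}$. Then $f=\mathcal R\{\varphi_n(s)\}$, i.e. $$f(x)=\sum_{k=0}^\infty\Delta_n^k\big(s^n\varphi_n(s)\big)_{n=0}\,\sqrt s\,L^*_{k}(x,s),$$ with convergence and equality in $L_2(0,\infty;e^{-sx})$. (ii) Conversely, let $s>0$, let $(\varphi_n(s))_{n\ge0}$ be a sequence belonging to $S_c$, and let $f=\mathcal R\{\varphi_n(s)\}$, i.e. $f\in L_2(0,\infty;e^{-sx})$ is the sum of the series $$f(x)=\sum_{k=0}^\infty\Delta_n^k\big(s^n\varphi_n(s)\big)_{n=0}\,\sqrt s\,L^*_{k}(x,s).$$ Then $\frac1{n!}\int_0^\infty e^{-st}t^nf(t)\,dt=\varphi_n(s)$ for every $n\in\mathbb N\cup\{0\}$.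
   Context: A function $f$ is of exponential order $r$ if there is $M>0$ such that $|f(t)|<Me^{rt}$ for all $t$. The Laplace-type transform $\mathcal G$ maps a function $f$ to the sequence $\varphi_n(s)=\frac{1}{n!}\int_0^\infty e^{-st}t^nf(t)\,dt$, $n\in\mathbb N\cup\{0\}$. The Laguerre polynomials are $L_k(x)=\sum_{j=0}^k(-1)^j\binom kj\frac{x^j}{j!}$, and $L^*_k(x,s)=(-1)^k\sqrt s\,L_k(sx)$; for fixed $s>0$ these functions of $x$ form an orthonormal basis of $L_2(0,\infty;e^{-sx})$, the Hilbert space of functions on $(0,\infty)$ square-integrable with weight $e^{-sx}$. $\Delta_n$ is the forward difference operator in $n$, $\Delta_n t_n=t_{n+1}-t_n$, so that $$\Delta_n^k\big(s^n\varphi_n(s)\big)_{n=0}=\sum_{j=0}^k(-1)^{k-j}\binom kj s^j\varphi_j(s).$$ $S_c$ is the space of real sequences $(t_n(s))_{n\ge0}$ such that $\sum_{k=0}^\infty\big\{\Delta_n^k(s^nt_n(s))_{n=0}\big\}^2<\infty$. The transform $\mathcal R$ maps $(\varphi_n(s))\in S_c$ to $\mathcal R\{\varphi_n(s)\}(x)=\sum_{k=0}^\infty\Delta_n^k\big(s^n\varphi_n(s)\big)_{n=0}\sqrt s\,L^*_k(x,s)$, the series converging in $L_2(0,\infty;e^{-sx})$. *)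

(* Defs.v *)
From HB Require Import structures.
From mathcomp Require Import all_boot all_order all_algebra.
From mathcomp Require Import all_classical all_reals all_analysis.
Import Order.TTheory GRing.Theory Num.Theory.
Import numFieldNormedType.Exports.

Set Implicit Arguments.
Unset Strict Implicit.
Unset Printing Implicit Defensive.

Local Open Scope classical_set_scope.
Local Open Scope ring_scope.

(* Functions on (0, oo) are represented by functions R -> R whose values
   outside (0, oo) are never used. *)
Section laguerre_transforms.
Context {R : realType}.
Implicit Types (f g : R -> R) (phi : R^nat) (r s x : R).

Local Notation mu := (@lebesgue_measure R).

(* Every [a, b] with 0 < a contains finitely many discontinuities, each with
   finite one-sided limits; at a point of continuity of f the one-sided limits
   exist anyway, so they may be required at every x > 0.  Discontinuities may
   accumulate at 0. *)
Definition piecewise_continuous f : Prop :=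
  (forall a b : R, 0 < a ->
     finite_set [set x | a <= x <= b /\ ~ {for x, continuous f}]) /\
  (forall x, 0 < x -> cvg (f y @[y --> x^'-]) /\ cvg (f y @[y --> x^'+])).

Definition exponential_order r f : Prop :=
  exists2 M : R, 0 < M & forall t, 0 < t -> `|f t| < M * expR (r * t).

Definition Gint s f n (t : R) : R := expR (- (s * t)) * t ^+ n * f t.

(* The Lebesgue integral below takes a junk value when Gint s f n is not
   integrable on (0, oo). *)
Definition Gtransform s f : R^nat :=
  fun n => n`!%:R^-1 * \int[mu]_(t in `]0, +oo[) Gint s f n t.

Definition laguerre k x : R :=
  \sum_(j < k.+1) (-1) ^+ j * 'C(k, j)%:R * (x ^+ j / j`!%:R).

Definition laguerre_star k x s : R :=
  (-1) ^+ k * Num.sqrt s * laguerre k (s * x).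

(* telescope is the forward difference operator u |-> (u_(n+1) - u_n)_n. *)
Definition diff_coef s phi (k : nat) : R :=
  iter k (@telescope R) (fun n => s ^+ n * phi n) 0%N.

Definition Sc s phi : Prop := cvgn (series (fun k => diff_coef s phi k ^+ 2)).

Definition sqnormL2 s f : \bar R :=
  (\int[mu]_(x in `]0%R, +oo[) (expR (- (s * x)) * f x ^+ 2)%:E)%E.

(* f is a representative of an element of L_2(0, oo; e^(-sx)). *)
Definition inL2 s f : Prop :=
  measurable_fun (`]0, +oo[%classic : set R) f /\ (sqnormL2 s f < +oo)%E.

Definition Rpartial s phi (K : nat) x : R :=
  \sum_(0 <= k < K) diff_coef s phi k * Num.sqrt s * laguerre_star k x s.

(* phi is in the domain S_c of the transform and f represents the class
   in L_2(0, oo; e^(-sx)) which is the image of phi. *)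
Definition is_Rtransform s phi f : Prop :=
  [/\ Sc s phi, inL2 s f &
      sqnormL2 s (fun x => f x - Rpartial s phi K x) @[K --> \oo] --> 0%E].

End laguerre_transforms.

(* Main.v *)
Require Import Defs.
From mathcomp Require Import all_boot all_order all_algebra.
From mathcomp Require Import all_classical all_reals all_analysis.
From mathcomp Require Import measurable_realfun ring lra.
Import Order.TTheory GRing.Theory Num.Theory.
Import numFieldNormedType.Exports.

Local Open Scope classical_set_scope.
Local Open Scope ring_scope.

Set Implicit Arguments.
Unset Strict Implicit.
Unset Printing Implicit Defensive.

(** Multiplication by e^(-sx/2) identifies L_2(0, oo; e^(-sx)) with the
unweighted L_2(0, oo) and sends L*_k(., s) to an orthonormal system psi_k
([lagfun_orthonormal]).  Since the n-th moment of f against e^(-sx) is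
n! phi_n, expanding the Laguerre polynomial gives
<f, psi_k> = sqrt s Delta^k (s^n phi_n)_(n = 0) ([ip_lagfun]).  So the series
defining R is the orthogonal expansion of f, and the theorem splits as follows.

Part (i) is the completeness of the Laguerre system, for the functions at hand.
Call a function expandable when the remainders of its expansion tend to 0.
Expandable functions form a closed subspace ([expandable_limit]).  It contains
e^(-bx) for every b > -s/2: the coefficients of e^(-bx) form a geometric
sequence, and their squares add up exactly to 1/(s + 2b), the squared norm
([expandable_exp]).  It remains to approximate f by linear combinations of such
exponentials.  Put F(v) = e^(-rx) f(x) with v = e^(-x), a bounded function on
(0, 1); then f(x) is approximated by e^(rx) (B_n F)(e^(-x)), where B_n is the
Bernstein operator.  Expanding the polynomial B_n F gives exponentials
e^((r - j)x), j >= 0, all admissible because s > 2r.  The Bernstein polynomials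
of a bounded function converge wherever it is continuous ([bernstein_cvg]),
that is, outside a countable set of x, and everything is dominated by a multiple
of e^(rx), which is square integrable for the weight, again because s > 2r.
Dominated convergence concludes ([approximant_cvgL2]).

In part (ii), square summability of the coefficients makes the partial sums a
Cauchy sequence, which converges by the Riesz-Fischer theorem
([riesz_fischer]).  If f is the sum, then by Cauchy-Schwarz the moments of f are
the limits of the moments of the partial sums.  These are eventually constant,
because psi_k is orthogonal to the monomials of degree less than k, and their
value is n! s^(-n) sum_k 'C(n, k) Delta^k (s^m phi_m)_(m = 0), which is n! phi_n
by Newton's forward difference formula ([ip_Rpartial_monomial]). *)

(** * Square integrable functions and orthonormal expansions *)

Section square_integrable.
Context d (T : measurableType d) (R : realType).
Variables (mu : {measure set T -> \bar R}) (D : set T).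
Hypothesis mD : measurable D.
Implicit Types f g h : T -> R.

Definition sqint f : Prop :=
  measurable_fun D f /\ (\int[mu]_(x in D) (f x ^+ 2)%:E < +oo)%E.

Definition ip f g : R := \int[mu]_(x in D) (f x * g x).

Lemma sqint_integrable_sqr f :
  sqint f -> mu.-integrable D (fun x => (f x ^+ 2)%:E).
Proof.
move=> [mf fy]; apply/integrableP; split.
  by apply/measurable_EFinP; exact: measurable_funX.
under eq_integral do rewrite gee0_abs ?lee_fin ?sqr_ge0//.
exact: fy.
Qed.

Lemma sqint_integrable f g : sqint f -> sqint g ->
  mu.-integrable D (EFin \o (fun x => f x * g x)).
Proof.
move=> sf sg; have [mf _] := sf; have [mg _] := sg.
apply: (@le_integrable _ _ _ mu D mD _
  (fun x => (f x ^+ 2)%:E + (g x ^+ 2)%:E)%E).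
- by apply/measurable_EFinP; exact: measurable_funM.
- move=> x _ /=; rewrite lee_fin.
  rewrite [leRHS]ger0_norm ?addr_ge0 ?sqr_ge0//.
  rewrite ler_norml; apply/andP; split; nra.
- by apply: integrableD => //; exact: sqint_integrable_sqr.
Qed.

Lemma sqintZ a f : sqint f -> sqint (fun x => a * f x).
Proof.
move=> sf; have [mf _] := sf; split.
  by apply: measurable_funM => //; exact: measurable_cst.
have := integrableZl mD (a ^+ 2) (sqint_integrable_sqr sf).
move=> /integrable_lty /=.
by under eq_integral do rewrite -EFinM -exprMn; apply.
Qed.

Lemma sqintD f g : sqint f -> sqint g -> sqint (fun x => f x + g x).
Proof.
move=> sf sg; have [mf _] := sf; have [mg _] := sg; split.
  exact: measurable_funD.
have h1 := integrableZl mD 2 (sqint_integrable sf sg).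
have h2 := integrableD mD (sqint_integrable_sqr sf) (sqint_integrable_sqr sg).
have /integrable_lty := integrableD mD h2 h1.
rewrite (_ : (\int[mu]_(x in D) _)%E =
  (\int[mu]_(x in D) ((f x + g x) ^+ 2)%:E)%E); first by apply.
by apply: eq_integral => x _ /=; rewrite -!EFinM -!EFinD; congr EFin; ring.
Qed.

Lemma sqint0 : sqint (fun=> 0).
Proof.
split; first exact: measurable_cst.
by under eq_integral do rewrite expr0n/=; rewrite integral0.
Qed.

Lemma sqintB f g : sqint f -> sqint g -> sqint (fun x => f x - g x).
Proof.
move=> sf /(sqintZ (-1)) sg; have := sqintD sf sg.
by under [X in sqint X]eq_fun do rewrite mulN1r.
Qed.

Lemma sqint_sum (c : R^nat) (e : nat -> T -> R) m n :
  (forall k, sqint (e k)) -> sqint (fun x => \sum_(m <= k < n) c k * e k x).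
Proof.
move=> se; elim: (index_iota m n) => [|k r ih].
  by under [X in sqint X]eq_fun do rewrite big_nil; exact: sqint0.
under [X in sqint X]eq_fun do rewrite big_cons.
by apply: sqintD => //; exact: sqintZ.
Qed.

Lemma ipC f g : ip f g = ip g f.
Proof. by apply: eq_Rintegral => x _; rewrite mulrC. Qed.

Lemma ip_ge0 f : 0 <= ip f f.
Proof. by apply: Rintegral_ge0 => x _; rewrite -expr2 sqr_ge0. Qed.

Lemma integral_sqrE f : sqint f ->
  (\int[mu]_(x in D) (f x ^+ 2)%:E = (ip f f)%:E)%E.
Proof.
move=> sf; rewrite /ip /Rintegral fineK; last first.
  by apply: integrable_fin_num => //; exact: sqint_integrable.
by apply: eq_integral => x _; rewrite expr2.
Qed.

Lemma ipDl f g h : sqint f -> sqint g -> sqint h ->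
  ip (fun x => f x + g x) h = ip f h + ip g h.
Proof.
move=> sf sg sh; rewrite /ip -RintegralD//; last 2 first.
- exact: sqint_integrable.
- exact: sqint_integrable.
by apply: eq_Rintegral => x _; rewrite mulrDl.
Qed.

Lemma ipZl a f h : sqint f -> sqint h -> ip (fun x => a * f x) h = a * ip f h.
Proof.
move=> sf sh; rewrite /ip -RintegralZl//; last exact: sqint_integrable.
by apply: eq_Rintegral => x _; rewrite mulrA.
Qed.

Lemma ipBl f g h : sqint f -> sqint g -> sqint h ->
  ip (fun x => f x - g x) h = ip f h - ip g h.
Proof.
move=> sf sg sh; rewrite -(mulN1r (ip g h)) -ipZl// -ipDl//; last exact: sqintZ.
by apply: eq_Rintegral => x _; rewrite mulN1r.
Qed.

Lemma ip_suml (c : R^nat) (e : nat -> T -> R) m n h :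
  (forall k, sqint (e k)) -> sqint h ->
  ip (fun x => \sum_(m <= k < n) c k * e k x) h =
  \sum_(m <= k < n) c k * ip (e k) h.
Proof.
move=> se sh; pose P r := fun x => \sum_(k <- r) c k * e k x.
have sP r : sqint (P r).
  rewrite /P; elim: r => [|k r ih].
    by under [X in sqint X]eq_fun do rewrite big_nil; exact: sqint0.
  under [X in sqint X]eq_fun do rewrite big_cons.
  by apply: sqintD => //; exact: sqintZ.
rewrite -/(P _); elim: (index_iota m n) => [|k r ih].
  rewrite big_nil /ip /P; under eq_Rintegral do rewrite big_nil mul0r.
  by rewrite /Rintegral integral0.
rewrite big_cons -ih -ipZl// -ipDl//; last exact: sqintZ.
by apply: eq_Rintegral => x _; rewrite /P big_cons.
Qed.

(** The quadratic form (a, b) |-> |af - bg|^2 is nonnegative; the choice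
(a, b) = (<g, g>, <f, g>) gives the claim up to the factor <g, g>. *)
Lemma cauchy_schwarz f g : sqint f -> sqint g ->
  ip f g ^+ 2 <= ip f f * ip g g.
Proof.
move=> sf sg.
have key a b : 0 <= a ^+ 2 * ip f f - 2 * a * b * ip f g + b ^+ 2 * ip g g.
  have saf := sqintZ a sf; have sbg := sqintZ b sg.
  have := ip_ge0 (fun x => a * f x - b * g x).
  rewrite ipBl//; last exact: sqintB.
  rewrite !(ipC _ (fun x => a * f x - b * g x)) !ipBl//.
  rewrite !ipZl// !(ipC _ (fun x => _ * _)) !ipZl// (ipC g f).
  by move=> h; apply: le_trans h _; rewrite le_eqVlt; apply/orP; left; apply/eqP; ring.
have ff := ip_ge0 f; have gg := ip_ge0 g.
have [g0|g0] := eqVneq (ip g g) 0.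
  have [->|fg0] := eqVneq (ip f g) 0; first by rewrite expr0n/= mulr_ge0.
  (* When <g, g> = 0 the form is affine in b, and this b makes it equal to -1. *)
  have := key 1 ((ip f f + 1) / (2 * ip f g)).
  rewrite g0 mulr0 addr0 expr1n mul1r mulr1.
  have -> : 2 * ((ip f f + 1) / (2 * ip f g)) * ip f g = ip f f + 1 by field.
  by lra.
have gp : 0 < ip g g by rewrite lt_neqAle eq_sym g0.
have h := key (ip g g) (ip f g).
rewrite -subr_ge0 -(pmulr_rge0 _ gp).
by apply: le_trans h _; rewrite le_eqVlt; apply/orP; left; apply/eqP; ring.
Qed.

(** Half of the parallelogram identity; it replaces the triangle inequality, so
that no square root of a norm is ever needed. *)
Lemma ip_add_le f g : sqint f -> sqint g ->
  ip (fun x => f x + g x) (fun x => f x + g x) <= 2 * (ip f f + ip g g).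
Proof.
move=> sf sg.
have := ip_ge0 (fun x => f x - g x).
have sB := sqintB sf sg; have sD := sqintD sf sg.
rewrite ipBl// (ipDl _ _ sD)//.
rewrite !(ipC _ (fun x => f x - g x)) !(ipC _ (fun x => f x + g x)).
rewrite !ipBl// !ipDl// (ipC g f); lra.
Qed.

Section orthonormal.
Variable e : nat -> T -> R.
Hypothesis se : forall k, sqint (e k).
Hypothesis oe : forall j k, ip (e j) (e k) = (j == k)%:R.

Lemma ip_sum_orthonormal (c : R^nat) m n :
  ip (fun x => \sum_(m <= k < n) c k * e k x)
     (fun x => \sum_(m <= k < n) c k * e k x) = \sum_(m <= k < n) c k ^+ 2.
Proof.
have sP := sqint_sum c m n se.
rewrite ip_suml//; apply: eq_big_nat => k mkn.
rewrite ipC ip_suml// (bigD1_seq k) ?mem_index_iota ?iota_uniq//=.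
rewrite oe eqxx mulr1 big1 ?addr0 ?expr2// => j jk.
by rewrite oe (negbTE jk) mulr0.
Qed.

Definition fourier_rest f (n : nat) : T -> R :=
  fun x => f x - \sum_(0 <= k < n) ip f (e k) * e k x.

Lemma sqint_fourier_rest f n : sqint f -> sqint (fourier_rest f n).
Proof. by move=> sf; apply: sqintB => //; exact: sqint_sum. Qed.

(** The partial sum is the orthogonal projection of f: both its pairing with f
and its squared norm are the sum of the squared coefficients. *)
Lemma pythagoras f n : sqint f ->
  ip (fourier_rest f n) (fourier_rest f n) =
  ip f f - \sum_(0 <= k < n) ip f (e k) ^+ 2.
Proof.
move=> sf; set S := \sum_(0 <= k < n) _.
set P := fun x => \sum_(0 <= k < n) ip f (e k) * e k x.
have sP : sqint P by exact: sqint_sum.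
have PP : ip P P = S by exact: ip_sum_orthonormal.
have Pf : ip P f = S.
  by rewrite /P ip_suml//; apply: eq_bigr => k _; rewrite ipC -expr2.
have -> : fourier_rest f n = (fun x => f x - P x) by [].
have sB := sqintB sf sP.
by rewrite ipBl// !(ipC _ (fun x => f x - P x)) !ipBl// (ipC f P) PP Pf; ring.
Qed.

Lemma bessel f n : sqint f -> \sum_(0 <= k < n) ip f (e k) ^+ 2 <= ip f f.
Proof. by move=> sf; rewrite -subr_ge0 -pythagoras// ip_ge0. Qed.

Definition expandable f : Prop :=
  ip (fourier_rest f n) (fourier_rest f n) @[n --> \oo] --> (0 : R).

Lemma fourier_restD f g n : sqint f -> sqint g ->
  fourier_rest (fun x => f x + g x) n =
  (fun x => fourier_rest f n x + fourier_rest g n x).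
Proof.
move=> sf sg; apply/funext => x; rewrite /fourier_rest.
rewrite addrACA -opprD -big_split/=; congr (_ - _); apply: eq_bigr => k _.
by rewrite ipDl// mulrDl.
Qed.

Lemma expandableD f g : sqint f -> sqint g ->
  expandable f -> expandable g -> expandable (fun x => f x + g x).
Proof.
move=> sf sg ef eg; rewrite /expandable.
apply: (@squeeze_cvgr _ _ _ _ (fun=> 0)
  (fun n => 2 * (ip (fourier_rest f n) (fourier_rest f n) +
                 ip (fourier_rest g n) (fourier_rest g n)))).
- near=> n; rewrite ip_ge0/= fourier_restD// ip_add_le//.
  + exact: sqint_fourier_rest.
  + exact: sqint_fourier_rest.
- exact: cvg_cst.
- have := cvgM (cvg_cst (2 : R)) (cvgD ef eg).
  by rewrite addr0 mulr0; apply.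
Unshelve. all: by end_near. Qed.

Lemma expandableZ a f : sqint f -> expandable f ->
  expandable (fun x => a * f x).
Proof.
move=> sf ef; rewrite /expandable.
have -> : (fun n => ip (fourier_rest (fun x => a * f x) n)
                       (fourier_rest (fun x => a * f x) n)) =
          (fun n => a ^+ 2 * ip (fourier_rest f n) (fourier_rest f n)).
  apply/funext => n.
  have -> : fourier_rest (fun x => a * f x) n =
            (fun x => a * fourier_rest f n x).
    apply/funext => x; rewrite /fourier_rest mulrBr; congr (_ - _).
    by rewrite mulr_sumr; apply: eq_bigr => k _; rewrite ipZl// mulrA.
  have sr := sqint_fourier_rest n sf.
  have sar := sqintZ a sr.
  rewrite [LHS](ipZl a sr sar) (ipC _ (fun x => a * _)) (ipZl a sr sr).
  by rewrite mulrA -expr2.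
have := cvgM (cvg_cst (a ^+ 2)) ef.
by rewrite mulr0; apply.
Qed.

(** By Bessel's inequality the remainder map does not increase norms, so the
remainder of f is controlled by that of a nearby g plus the distance to g. *)
Lemma expandable_limit f : sqint f ->
  (forall eps, 0 < eps -> exists g, [/\ sqint g, expandable g &
    ip (fun x => f x - g x) (fun x => f x - g x) < eps]) ->
  expandable f.
Proof.
move=> sf H; apply/cvgrPdist_lt => eps eps0.
have [|g [sg eg fg]] := H (eps / 4); first by rewrite divr_gt0.
have sh : sqint (fun x => f x - g x) by exact: sqintB.
have -> : f = (fun x => (f x - g x) + g x) by apply/funext => x; rewrite subrK.
have eg' := @cvgr_lt _ _ _ _ _ _ eg (eps / 4).
near=> n; rewrite sub0r normrN ger0_norm ?ip_ge0//.
rewrite fourier_restD//.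
apply: le_lt_trans (ip_add_le (sqint_fourier_rest _ sh) (sqint_fourier_rest _ sg)) _.
have h1 : ip (fourier_rest (fun x => f x - g x) n)
            (fourier_rest (fun x => f x - g x) n) < eps / 4.
  rewrite pythagoras//; apply: le_lt_trans fg; rewrite lerBlDr lerDl.
  by apply: sumr_ge0 => k _; exact: sqr_ge0.
have h2 : ip (fourier_rest g n) (fourier_rest g n) < eps / 4.
  by near: n; apply: eg'; rewrite divr_gt0.
rewrite [ltRHS](_ : _ = 2 * (eps / 4 + eps / 4)); last by field.
by rewrite (ltr_pM2l (ltr0Sn R 1)); exact: (ltrD h1 h2).
Unshelve. all: by end_near. Qed.

Lemma expandable_sum (c : R^nat) (u : nat -> T -> R) m n :
  (forall k, sqint (u k)) -> (forall k, expandable (u k)) ->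
  expandable (fun x => \sum_(m <= k < n) c k * u k x).
Proof.
move=> su eu.
suff: forall r : seq nat, sqint (fun x => \sum_(k <- r) c k * u k x) /\
  expandable (fun x => \sum_(k <- r) c k * u k x) by move=> /(_ (index_iota m n))[].
elim=> [|k r [ih1 ih2]].
  have -> : (fun x : T => \sum_(k <- [::]) c k * u k x) = (fun x => 0 * u 0%N x).
    by apply/funext => x; rewrite big_nil mul0r.
  by split; [exact: sqintZ|exact: expandableZ].
have -> : (fun x : T => \sum_(j <- k :: r) c j * u j x) =
  (fun x => c k * u k x + \sum_(j <- r) c j * u j x).
  by apply/funext => x; rewrite big_cons.
split; first by apply: sqintD => //; exact: sqintZ.
exact: (expandableD (sqintZ (c k) (su k)) ih1
  (expandableZ (c k) (su k) (eu k)) ih2).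
Qed.

End orthonormal.
End square_integrable.

(** * Completeness of the space of square integrable functions *)

(** The hypothesis bounds the j-th increment by a multiple of 2^(-j), so the
increments are absolutely summable. *)
Lemma cvgn_of_weighted_increments (R : realType) (v : R^nat) (C : R) :
  (forall j, 4 ^+ j * telescope v j ^+ 2 <= C) -> cvgn v.
Proof.
move=> vC.
have C0 : 0 <= C by apply: le_trans (vC 0%N); rewrite mul1r sqr_ge0.
have wle j : `|telescope v j| <= geometric (Num.sqrt C) 2^-1 j.
  rewrite /geometric/=.
  rewrite -(@ler_pXn2r _ 2) ?nnegrE ?mulr_ge0 ?sqrtr_ge0 ?exprn_ge0//.
  have -> : (Num.sqrt C * 2^-1 ^+ j) ^+ 2 = C / 4 ^+ j.
    rewrite exprMn sqr_sqrtr// -exprVn -exprM mulnC exprM; congr (_ * _ ^+ j).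
    by field.
  by rewrite real_normK ?num_real// ler_pdivlMr ?exprn_gt0// mulrC.
have cw : cvgn (series (telescope v)).
  apply: normed_cvg; apply: (series_le_cvg _ _ wle).
  - by move=> n; exact: normr_ge0.
  - by move=> n; apply: le_trans (wle n).
  - by apply: is_cvg_geometric_series; rewrite ger0_norm ?invf_lt1// ltr1n.
have -> : v = (fun n => v 0%N + series (telescope v) n).
  by apply/funext => n; rewrite -eq_sum_telescope.
by apply: is_cvgD => //; exact: is_cvg_cst.
Qed.

Section riesz_fischer.
Context d (T : measurableType d) (R : realType).
Variables (mu : {measure set T -> \bar R}) (D : set T).
Hypothesis mD : measurable D.

(** The integral of sum_j 4^j (v_(j+1) - v_j)^2 is at most sum_j 2^(-j-1) = 1,
hence this sum is finite almost everywhere. *)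
Lemma ae_cvg_of_fast_increments (v : nat -> T -> R) :
  (forall j, sqint mu D (v j)) ->
  (forall j, ip mu D (fun x => v j.+1 x - v j x) (fun x => v j.+1 x - v j x)
     <= (4 ^+ j)^-1 / (2 ^ j.+1)%:R) ->
  {ae mu, forall x, D x -> cvgn (v ^~ x)}.
Proof.
move=> sv vle.
have sw j : sqint mu D (fun x => v j.+1 x - v j x) by exact: sqintB.
pose h j x := (4 ^+ j * (v j.+1 x - v j x) ^+ 2)%:E.
have h0 j x : D x -> (0 <= h j x)%E.
  by move=> _; rewrite lee_fin mulr_ge0 ?sqr_ge0// exprn_ge0.
have mh j : measurable_fun D (h j).
  apply/measurable_EFinP; apply: measurable_funM; first exact: measurable_cst.
  by apply: measurable_funX; case: (sw j).
pose S x := (\sum_(0 <= j <oo) h j x)%E.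
have mS : measurable_fun D S.
  by apply: ge0_emeasurable_sum => // j x Dx _; exact: h0.
have iS : mu.-integrable D S.
  apply/integrableP; split => //.
  rewrite (eq_integral S); last first.
    move=> x /set_mem Dx; rewrite gee0_abs//.
    by apply: nneseries_ge0 => n _ _; exact: h0.
  rewrite /S integral_nneseries//.
  apply: (@le_lt_trans _ _ (\sum_(0 <= j <oo) (1 / (2 ^ j.+1)%:R : R)%:E)%E).
    apply: lee_nneseries => [i _ _|j _].
      by apply: integral_ge0 => x; exact: h0.
    rewrite (eq_integral (fun x => ((4 ^+ j)%:E * ((v j.+1 x - v j x) ^+ 2)%:E)%E));
      last by move=> x _; rewrite -EFinM.
    have mw2 : measurable_fun D (fun x => ((v j.+1 x - v j x) ^+ 2)%:E).
      by apply/measurable_EFinP/measurable_funX; case: (sw j).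
    have w20 x : D x -> (0 <= ((v j.+1 x - v j x) ^+ 2)%:E)%E.
      by rewrite lee_fin sqr_ge0.
    rewrite (ge0_integralZl_EFin mu mD w20 mw2) ?exprn_ge0//.
    rewrite (integral_sqrE mD (sw j)) -EFinM lee_fin.
    rewrite mulrC -ler_pdivlMr ?exprn_gt0//.
    by apply: le_trans (vle j) _; rewrite mul1r mulrC.
  apply: le_lt_trans (epsilon_trick0 xpredT ler01) _.
  by rewrite ltry.
have := integrable_ae mD iS; apply: filterS => x Sfin Dx.
have /fineK SE := Sfin Dx.
apply: (@cvgn_of_weighted_increments _ _ (fine (S x))) => j.
rewrite -lee_fin SE /S.
apply: le_trans (nneseries_lim_ge j.+1 _); last by move=> n _ _; exact: h0.
by rewrite big_nat_recr//= leeDr// sume_ge0// => i _; exact: h0.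
Qed.

Lemma limn_einf_le (u : (\bar R)^nat) (c : \bar R) :
  (\forall n \near \oo, (u n <= c)%E) -> (limn_einf u <= c)%E.
Proof.
move=> uc; rewrite limn_einf_lim; apply: lime_le; first exact: is_cvg_einfs.
near=> n; apply: (@le_trans _ _ (u n)); last by near: n.
by apply: ereal_inf_lbound; exists n => //=.
Unshelve. all: by end_near. Qed.

Lemma measurable_fun_limn_einf (f : (T -> \bar R)^nat) :
  (forall n, measurable_fun D (f n)) ->
  measurable_fun D (fun x => limn_einf (f ^~ x)).
Proof.
move=> mf.
have -> : (fun x => limn_einf (f ^~ x)) =
    (fun x => - limn_esup (fun n => - f n x))%E.
  apply/funext => x; rewrite -limn_einfN; congr limn_einf.
  by apply/funext => n /=; rewrite oppeK.
apply: measurableT_comp => //; apply: measurable_fun_limn_esup => n.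
exact: measurableT_comp.
Qed.

(** A fast Cauchy subsequence converges almost everywhere; by Fatou's lemma
along it, the distance from the limit to u_n is at most the limit of the
distances within the subsequence, which the Cauchy condition controls. *)
Theorem riesz_fischer (u : nat -> T -> R) :
  (forall n, sqint mu D (u n)) ->
  (forall eps, 0 < eps -> exists N, forall m n, (N <= m)%N -> (N <= n)%N ->
     ip mu D (fun x => u m x - u n x) (fun x => u m x - u n x) <= eps) ->
  exists2 f, sqint mu D f &
    ip mu D (fun x => f x - u n x) (fun x => f x - u n x) @[n --> \oo] --> (0:R).
Proof.
move=> su cu.
have /choice[N HN] : forall j, exists N, forall m n, (N <= m)%N -> (N <= n)%N ->
    ip mu D (fun x => u m x - u n x) (fun x => u m x - u n x)
      <= (4 ^+ j)^-1 / (2 ^ j.+1)%:R.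
  move=> j; apply: cu.
  by rewrite divr_gt0 ?invr_gt0 ?exprn_gt0// ltr0n expn_gt0.
(* Summing the N i makes k j exceed all the N i with i <= j; the summand j
   makes k tend to infinity. *)
pose k j := (j + \sum_(i < j.+1) N i)%N.
have Nk i j : (i <= j)%N -> (N i <= k j)%N.
  move=> ij; apply: leq_trans (leq_addl _ _).
  have ij' : (i < j.+1)%N by [].
  by rewrite (bigD1 (Ordinal ij'))//= leq_addr.
pose v j := u (k j).
have sv j : sqint mu D (v j) by exact: su.
have vcvg : {ae mu, forall x, D x -> cvgn (v ^~ x)}.
  by apply: ae_cvg_of_fast_increments => // j; apply: HN; exact: Nk.
have mv j : measurable_fun D (EFin \o v j).
  by apply/measurable_EFinP; case: (sv j).
(* The upper limit is measurable without any convergence assumption. *)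
pose f x := fine (limn_esup (fun j => (v j x)%:E)).
have mf : measurable_fun D f.
  apply: (@measurableT_comp _ _ _ _ _ _ fine) => //.
  exact: measurable_fun_limn_esup.
have vf : {ae mu, forall x, D x -> v ^~ x @ \oo --> f x}.
  apply: filterS vcvg => x vx Dx; have cx := vx Dx.
  suff -> : f x = limn (v ^~ x) by [].
  have cE : (fun j => (v j x)%:E) @ \oo --> (limn (v ^~ x))%:E.
    by apply: cvg_EFin => //; exact: nearW.
  by rewrite /f (cvg_limn_einf_sup cE).2.
(* The integral is bounded before f is known to be square integrable; this also
   yields the latter. *)
have fatou_le n eps : (\forall j \near \oo,
      ip mu D (fun x => v j x - u n x) (fun x => v j x - u n x) <= eps) ->
    (\int[mu]_(x in D) ((f x - u n x) ^+ 2)%:E <= eps%:E)%E.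
  move=> jle; pose g j x := ((v j x - u n x) ^+ 2)%:E.
  have svu j : sqint mu D (fun x => v j x - u n x) by exact: sqintB.
  have mg j : measurable_fun D (g j).
    by apply/measurable_EFinP/measurable_funX; case: (svu j).
  have g0 j x : D x -> (0 <= g j x)%E by move=> _; rewrite lee_fin sqr_ge0.
  apply: (@le_trans _ _ (\int[mu]_(x in D) limn_einf (g ^~ x))%E).
    apply: ae_ge0_le_integral => //.
    - by move=> x _; rewrite lee_fin sqr_ge0.
    - apply/measurable_EFinP/measurable_funX/measurable_funB => //.
      by case: (su n).
    - move=> x Dx; rewrite limn_einf_lim; apply: lime_ge.
        exact: is_cvg_einfs.
      by apply: nearW => m; apply: le_ereal_inf_tmp => _ [i /= _ <-]; exact: g0.
    - exact: measurable_fun_limn_einf.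
    - apply: filterS vf => x vx Dx.
      have gx : g ^~ x @ \oo --> ((f x - u n x) ^+ 2)%:E.
        apply: cvg_EFin; first exact: nearW.
        have h : (fun j => v j x - u n x) @ \oo --> f x - u n x.
          by apply: cvgB; [exact: vx|exact: cvg_cst].
        exact: (cvgM h h).
      by rewrite (cvg_limn_einf_sup gx).1.
  apply: le_trans (fatou mu mD mg g0) _.
  apply: limn_einf_le; apply: filterS jle => j hj.
  by rewrite (integral_sqrE mD (svu j)) lee_fin.
have kj j : (j <= k j)%N by exact: leq_addr.
have sqf : sqint mu D f.
  have [M HM] := cu 1 ltr01.
  have sfu : sqint mu D (fun x => f x - u M x).
    split; first by apply: measurable_funB => //; case: (su M).
    apply: (@le_lt_trans _ _ 1%:E); last by rewrite ltry.
    apply: fatou_le; near=> j; apply: HM => //.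
    by apply: leq_trans (kj j); near: j; exact: nbhs_infty_ge.
  have := sqintD mD sfu (su M).
  by under [X in sqint _ _ X]eq_fun do rewrite subrK.
exists f => //; apply/cvgrPdist_le => eps eps0.
have [M HM] := cu eps eps0.
near=> n; rewrite sub0r normrN ger0_norm ?ip_ge0// -lee_fin.
rewrite -(integral_sqrE mD); last exact: sqintB.
apply: fatou_le; near=> j; apply: HM.
- by apply: leq_trans (kj j); near: j; exact: nbhs_infty_ge.
- by near: n; exact: nbhs_infty_ge.
Unshelve. all: by end_near. Qed.

End riesz_fischer.

(** * Bernstein operators *)

Section bernstein.
Context {R : realType}.
Implicit Types (g h : R^nat) (u c : R).

(** The expectation of g at a binomial random variable with parameters n and u,
computed by conditioning on one trial.  Applied to g k = F(k / n) it is the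
n-th Bernstein polynomial of F at u; the recursion makes positivity, the
variance and polynomiality in u immediate inductions. *)
Fixpoint bernstein n g u : R :=
  if n is m.+1 then
    (1 - u) * bernstein m g u + u * bernstein m (fun k => g k.+1) u
  else g 0%N.

Lemma bernsteinD n g h u :
  bernstein n (fun k => g k + h k) u = bernstein n g u + bernstein n h u.
Proof. by elim: n g h => //= n ih g h; rewrite !ih; ring. Qed.

Lemma bernsteinZ n c g u :
  bernstein n (fun k => c * g k) u = c * bernstein n g u.
Proof. by elim: n g => //= n ih g; rewrite !ih; ring. Qed.

Lemma bernstein_cst n c u : bernstein n (fun=> c) u = c.
Proof. by elim: n => //= n ->; ring. Qed.

Lemma bernstein_le n g h u : 0 <= u <= 1 ->
  (forall k, g k <= h k) -> bernstein n g u <= bernstein n h u.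
Proof.
move=> /andP[u0 u1]; elim: n g h => [|n ih] g h gh /=; first exact: gh.
by apply: lerD; apply: ler_wpM2l; rewrite ?subr_ge0// ih// => k; exact: gh.
Qed.

Lemma bernstein_norm_le n g u M : 0 <= u <= 1 ->
  (forall k, `|g k| <= M) -> `|bernstein n g u| <= M.
Proof.
move=> u01 gM; rewrite ler_norml -(bernstein_cst n (- M) u).
rewrite -{2}(bernstein_cst n M u); apply/andP; split; apply: bernstein_le => // k;
  by have := gM k; rewrite ler_norml => /andP[].
Qed.

(** The second moment about c: the variance n u (1 - u) plus the squared bias.
Leaving c arbitrary is what lets the induction go through, since conditioning
on a success shifts c by 1. *)
Lemma bernstein_sqr n c u :
  bernstein n (fun k => (k%:R - c) ^+ 2) u =
  n%:R * u * (1 - u) + (n%:R * u - c) ^+ 2.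
Proof.
elim: n c => [|n ih] c /=; first by ring.
have -> : (fun k => (k.+1%:R - c) ^+ 2) = (fun k => (k%:R - (c - 1)) ^+ 2) :> R^nat.
  by apply/funext => k; rewrite -natr1; ring.
by rewrite !ih -natr1; ring.
Qed.

Lemma bernstein_horner n g : exists p : {poly R},
  forall u, bernstein n g u = p.[u].
Proof.
elim: n g => [|n ih] g; first by exists (g 0%N)%:P => u; rewrite hornerC.
have [p hp] := ih g; have [q hq] := ih (fun k => g k.+1).
by exists ((1 - 'X) * p + 'X * q) => u /=; rewrite hp hq !hornerE.
Qed.

(** Chebyshev's argument.  Continuity at u only and boundedness give
|F v - F u| <= eps/2 + (2M/delta^2) (v - u)^2 for all v, and the operator turns
the last term into a multiple of the variance, which is O(1/n). *)
Lemma bernstein_cvg (F : R -> R) (M u : R) : 0 <= u <= 1 ->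
  (forall v, `|F v| <= M) -> {for u, continuous F} ->
  bernstein n.+1 (fun k => F (k%:R / n.+1%:R)) u @[n --> \oo] --> F u.
Proof.
move=> u01 FM cF; apply/cvgrPdist_lt => eps eps0.
have M0 : 0 <= M by apply: le_trans (FM 0).
have := cF; move/cvgrPdist_lt => /(_ (eps / 2)) [|dl /= dl0 Fd].
  by rewrite divr_gt0.
have Fq v : `|F v - F u| <= eps / 2 + 2 * M / dl ^+ 2 * (v - u) ^+ 2.
  have [vu|vu] := ltP `|u - v| dl.
    rewrite distrC; apply: le_trans (ltW (Fd _ vu)) _.
    by rewrite lerDl mulr_ge0 ?sqr_ge0// divr_ge0 ?sqr_ge0// mulr_ge0.
  have : `|F v - F u| <= 2 * M.
    by apply: le_trans (ler_normB _ _) _; have := FM v; have := FM u; lra.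
  move=> /le_trans; apply; apply: ler_wpDl; first by rewrite divr_ge0// ltW.
  rewrite mulrAC ler_pdivlMr ?exprn_gt0//.
  apply: ler_wpM2l; first by rewrite mulr_ge0.
  by rewrite -(real_normK (num_real (v - u))) distrC lerXn2r ?nnegrE// ltW.
pose C := 2 * M / dl ^+ 2.
have C0 : 0 <= C by rewrite divr_ge0 ?sqr_ge0// mulr_ge0.
have CN : \forall n \near \oo, C / n.+1%:R < eps / 2.
  near=> n; rewrite ltr_pdivrMr// -ltr_pdivrMl ?divr_gt0//.
  apply: (@lt_trans _ _ n%:R); last by rewrite ltr_nat.
  by near: n; exact: nbhs_infty_gtr.
near=> n; rewrite distrC.
set N : R := n.+1%:R; have N0 : 0 < N by rewrite ltr0n.
have -> : bernstein n.+1 (fun k => F (k%:R / N)) u - F u =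
    bernstein n.+1 (fun k => F (k%:R / N) - F u) u.
  by rewrite bernsteinD bernstein_cst.
have B : bernstein n.+1 (fun k => eps / 2 + C / N ^+ 2 * (k%:R - N * u) ^+ 2) u
    = eps / 2 + C * u * (1 - u) / N.
  rewrite bernsteinD bernstein_cst bernsteinZ bernstein_sqr -/N subrr.
  by rewrite expr0n/= addr0; field; rewrite gt_eqF.
have Ck k : `|F (k%:R / N) - F u| <=
    eps / 2 + C / N ^+ 2 * (k%:R - N * u) ^+ 2.
  apply: le_trans (Fq _) _; rewrite lerD2l -/C le_eqVlt; apply/orP; left.
  by apply/eqP; field; rewrite gt_eqF.
apply: (@le_lt_trans _ _ (eps / 2 + C * u * (1 - u) / N)).
  rewrite ler_norml -B; apply/andP; split.
    rewrite -mulN1r -bernsteinZ; apply: bernstein_le => // k.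
    by have := Ck k; rewrite ler_norml mulN1r => /andP[].
  by apply: bernstein_le => // k; have := Ck k; rewrite ler_norml => /andP[].
have : C / n.+1%:R < eps / 2 by near: n.
rewrite -/N.
have : C * u * (1 - u) / N <= C / N.
  rewrite ler_pM2r ?invr_gt0// -mulrA ler_piMr//; nra.
by move=> h1 h2; rewrite [ltRHS]splitr ltrD2l (le_lt_trans h1).
Unshelve. all: by end_near. Qed.

End bernstein.

(** * Iterated forward differences *)

Section finite_differences.
Context {R : realType}.
Implicit Types (u : R^nat).

(** Delta^k is the binomial expansion of (shift - 1)^k. *)
Lemma iter_telescopeE u k n :
  iter k (@telescope R) u n =
  \sum_(0 <= j < k.+1) (-1) ^+ (k + j) * 'C(k, j)%:R * u (n + j)%N.
Proof.
elim: k u n => [|k ih] u n.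
  by rewrite big_nat1 bin0 !addn0 expr0 !mul1r.
rewrite iterSr ih.
have -> : \sum_(0 <= j < k.+2) (-1) ^+ (k.+1 + j) * 'C(k.+1, j)%:R * u (n + j)%N =
  \sum_(0 <= j < k.+2) (-1) ^+ (k.+1 + j) * 'C(k, j)%:R * u (n + j)%N +
  \sum_(0 <= j < k.+1) (-1) ^+ (k + j) * 'C(k, j)%:R * u (n + j.+1)%N.
  rewrite [in LHS]big_nat_recl// [in X in _ = X + _]big_nat_recl// !bin0 -addrA.
  congr (_ + _); rewrite -big_split/=; apply: eq_bigr => j _.
  by rewrite binS natrD !addSn !addnS !exprS; ring.
rewrite [X in _ = X + _]big_nat_recr//= bin_small// mulr0 mul0r addr0.
rewrite -big_split/=; apply: eq_bigr => j _.
by rewrite /telescope addnS addSn exprS /=; ring.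
Qed.

(** The sum may run up to any K > n because the binomials with k > n vanish. *)
Lemma newton_forward u n K : (n < K)%N ->
  \sum_(0 <= k < K) 'C(n, k)%:R * iter k (@telescope R) u 0%N = u n.
Proof.
elim: n u K => [|n ih] u [//|K] nK.
  rewrite big_nat_recl// big1 ?addr0 ?bin0 ?mul1r// => i _.
  by rewrite bin0n mul0r.
rewrite big_nat_recl// bin0.
transitivity (\sum_(0 <= k < K.+1) 'C(n, k)%:R * iter k (@telescope R) u 0%N +
  \sum_(0 <= k < K) 'C(n, k)%:R * iter k (@telescope R) (telescope u) 0%N).
  rewrite [in RHS]big_nat_recl// bin0 -addrA; congr (_ + _).
  rewrite -big_split/=; apply: eq_bigr => k _.
  by rewrite binS natrD mulrDl -iterSr.
rewrite !ih//; last exact: ltnW.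
by rewrite /telescope /= addrC subrK.
Qed.

Lemma iter_telescopeZ (c : R) u k :
  iter k (@telescope R) (fun n => c * u n) =
  (fun n => c * iter k (@telescope R) u n).
Proof.
by elim: k => //= k ->; apply/funext => n; rewrite /telescope /= mulrBr.
Qed.

(** Pascal's rule, iterated. *)
Lemma iter_telescope_bin m k :
  iter k (@telescope R) (fun n => 'C(n + m, n)%:R) =
  (fun n => 'C(n + m, n + k)%:R).
Proof.
elim: k => /= [|k ->]; apply/funext => n; first by rewrite addn0.
by rewrite /telescope /= !addSn addnS binS natrD addrK.
Qed.

Lemma iter_telescope_geometric (q : R) k :
  iter k (@telescope R) (fun n => q ^+ n) = (fun n => (q - 1) ^+ k * q ^+ n).
Proof.
elim: k => /= [|k ->]; apply/funext => n; first by rewrite mul1r.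
by rewrite /telescope /= !exprS; ring.
Qed.

End finite_differences.

(** * The integral of t^n e^(-ct) *)

Section gamma_integral.
Context {R : realType}.
Local Notation mu := (@lebesgue_measure R).
Variable c : R.
Hypothesis c0 : 0 < c.

(** e^(ct) dominates the (n + 1)-st term of its power series, so the quotient is
O(1/t). *)
Lemma cvg_poly_expN n : t ^+ n * expR (- (c * t)) @[t --> +oo] --> (0 : R).
Proof.
pose C := n.+1`!%:R / c ^+ n.+1.
apply: (@squeeze_cvgr _ _ _ _ (fun=> 0) (fun t => C * t^-1)); last 2 first.
- exact: cvg_cst.
- have tV : t^-1 @[t --> +oo] --> (0 : R).
    apply/cvgrPdist_lt => e e0; near=> t.
    have t0 : 0 < t by near: t; exact: nbhs_pinfty_gt.
    rewrite sub0r normrN gtr0_norm ?invr_gt0// -[e]invrK.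
    rewrite ltf_pV2 ?posrE ?invr_gt0//.
    by near: t; apply: nbhs_pinfty_gt; exact: num_real.
  by have := cvgMl_tmp (a := C) tV; rewrite mulr0; apply.
near=> t.
have t0 : 0 < t by near: t; exact: nbhs_pinfty_gt.
have ct0 : 0 < c * t by rewrite mulr_gt0.
apply/andP; split; first by rewrite mulr_ge0 ?expR_ge0// exprn_ge0// ltW.
have := expR_ge1Dxn n (ltW ct0).
move=> h; have {}h : (c * t) ^+ n.+1 / n.+1`!%:R <= expR (c * t).
  by apply: le_trans h; rewrite lerDr.
rewrite expRN ler_pdivrMr ?expR_gt0//.
apply: (@le_trans _ _ (C * t^-1 * ((c * t) ^+ n.+1 / n.+1`!%:R))).
  rewrite le_eqVlt; apply/orP; left; apply/eqP.
  rewrite /C exprMn !exprS; field.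
  by rewrite !gt_eqF//= ?exprn_gt0// ltr0n fact_gt0.
apply: ler_wpM2l => //; rewrite mulr_ge0 ?invr_ge0 ?ltW// /C.
by rewrite divr_gt0 ?exprn_gt0// ltr0n fact_gt0.
Unshelve. all: by end_near. Qed.

(** Integration by parts, read as a recursive definition of a primitive. *)
Fixpoint gamma_primitive n (t : R) : R :=
  - (t ^+ n * expR (- (c * t))) / c +
  if n is m.+1 then n%:R / c * gamma_primitive m t else 0.

Let is_derive_monomial_expN n (t : R) :
  is_derive t (1 : R) (fun x : R => x ^+ n * expR (- (c * x)) : R)
    (n%:R * t ^+ n.-1 * expR (- (c * t)) - t ^+ n * (c * expR (- (c * t)))).
Proof.
have dE : is_derive t (1 : R) (fun x : R => expR (- (c * x)) : R)
    (- c * expR (- (c * t))).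
  by apply: is_derive_eq; rewrite /GRing.scale/=; ring.
have dX : is_derive t (1 : R) (fun x : R => x ^+ n : R) (n%:R * t ^+ n.-1).
  have := is_deriveX n (is_derive_id t (1 : R)).
  by rewrite exprfctE /GRing.scale/= mulr1; apply.
by apply: is_derive_eq; rewrite /GRing.scale/=; ring.
Qed.

Lemma is_derive_gamma_primitive n (t : R) :
  is_derive t (1 : R) (gamma_primitive n) (t ^+ n * expR (- (c * t))).
Proof.
elim: n => [|n ih] /=.
  have dP := is_derive_monomial_expN 0 t.
  apply: is_derive_eq; rewrite /GRing.scale/=; field; exact: lt0r_neq0.
have dP := is_derive_monomial_expN n.+1 t.
apply: is_derive_eq; rewrite /GRing.scale/=.
by rewrite !exprS; field; exact: lt0r_neq0.
Qed.

Lemma gamma_primitive0 n : gamma_primitive n 0 = - (n`!%:R / c ^+ n.+1).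
Proof.
elim: n => [|n ih] /=; first by rewrite mulr0 oppr0 expR0 fact0 !mul1r addr0 expr1 mulNr mul1r.
rewrite ih expr0n/= mul0r oppr0 mul0r add0r factS natrM !exprS.
by field; rewrite expf_neq0 ?lt0r_neq0.
Qed.

Lemma cvg_gamma_primitive n : gamma_primitive n t @[t --> +oo] --> (0 : R).
Proof.
have h m : - (t ^+ m * expR (- (c * t))) / c @[t --> +oo] --> (0 : R).
  rewrite [X in _ --> X](_ : 0 = - 0 / c); last by rewrite oppr0 mul0r.
  by apply: cvgMr_tmp; apply: cvgN; exact: cvg_poly_expN.
elim: n => [|n ih] /=.
  rewrite [X in _ --> X](_ : 0 = 0 + 0); last by rewrite addr0.
  by apply: cvgD; [exact: h|exact: cvg_cst].
rewrite [X in _ --> X](_ : 0 = 0 + n.+1%:R / c * 0); last first.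
  by rewrite mulr0 addr0.
by apply: cvgD; [exact: h|apply: cvgMl_tmp].
Qed.

Lemma gamma_integral n :
  (\int[mu]_(t in `]0%R, +oo[) (expR (- (c * t)) * t ^+ n)%:E =
   (n`!%:R / c ^+ n.+1)%:E)%E.
Proof.
have cP : continuous (fun t : R => t ^+ n * expR (- (c * t))).
  move=> x; apply: differentiable_continuous; apply/derivable1_diffP.
  by have [] := is_derive_monomial_expN n x.
under eq_integral do rewrite mulrC.
rewrite integral_itv_obnd_cbnd; last first.
  by apply/measurable_EFinP/measurable_funTS; exact: continuous_measurable_fun.
have dP x := is_derive_gamma_primitive n x.
rewrite (@ge0_continuous_FTC2y _ _ (gamma_primitive n) _ 0).
- by rewrite gamma_primitive0 sub0e -EFinN opprK.
- by move=> x x0; rewrite mulr_ge0 ?expR_ge0// exprn_ge0.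
- exact: continuous_subspaceT.
- exact: cvg_gamma_primitive.
- by move=> x _; have [] := dP x.
- apply: cvg_at_right_filter.
  have [h _] := dP 0.
  by apply: differentiable_continuous; exact/derivable1_diffP.
- by move=> x _; rewrite derive1E derive_val mulrC.
Qed.

End gamma_integral.

(** * Laguerre functions *)

Section laguerre_functions.
Context {R : realType}.
Local Notation mu := (@lebesgue_measure R).
Local Notation D := (`]0%R, +oo[%classic : set R).
Implicit Types (s b x : R) (f g : R -> R).

Let mD : measurable D := measurable_itv _.

(** The isometry from the space with weight e^(-sx) onto the unweighted space;
its inverse is the same map for -s. *)
Definition wt s f : R -> R := fun x => expR (- (s * x) / 2) * f x.

Lemma wtM s f g x : wt s f x * wt s g x = expR (- (s * x)) * (f x * g x).
Proof.
by rewrite /wt mulrACA -expRD; congr (expR _ * _); field.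
Qed.

Lemma sqnormL2E s f :
  sqnormL2 s f = (\int[mu]_(x in D) (wt s f x ^+ 2)%:E)%E.
Proof. by apply: eq_integral => x _; rewrite !expr2 wtM. Qed.

Lemma measurable_expR_scale (b : R) : measurable_fun D (fun x => expR (b * x)).
Proof.
apply: measurableT_comp; first exact: measurable_expR.
by apply: measurable_funM => //; exact: measurable_cst.
Qed.

Lemma measurable_wt s f : measurable_fun D f -> measurable_fun D (wt s f).
Proof.
move=> mf; apply: measurable_funM => //.
have := measurable_expR_scale (- (s / 2)); congr measurable_fun.
by apply/funext => x; congr expR; field.
Qed.

Lemma wtK s f : wt s (wt (- s) f) = f.
Proof.
apply/funext => x; rewrite /wt mulrA -expRD.
by rewrite (_ : _ + _ = 0) ?expR0 ?mul1r//; field.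
Qed.

Lemma inL2E s f : inL2 s f <-> sqint mu D (wt s f).
Proof.
rewrite /inL2 /sqint sqnormL2E; split => -[mf fy]; split => //.
  exact: measurable_wt.
rewrite -(wtK (- s) f) opprK; exact: measurable_wt.
Qed.

(** One family for the two kinds of functions whose Laguerre coefficients are
needed: the monomials (b = 0) and the exponentials (m = 0). *)
Definition expmon b m : R -> R := fun x => expR (- (b * x)) * x ^+ m.

Lemma measurable_expmon b m : measurable_fun D (expmon b m).
Proof.
apply: measurable_funM.
  have := measurable_expR_scale (- b); congr measurable_fun.
  by apply/funext => x; rewrite mulNr.
exact: exprn_measurable.
Qed.

Lemma wt_expmonM s b b' m m' x :
  wt s (expmon b m) x * wt s (expmon b' m') x =
  expR (- ((s + b + b') * x)) * x ^+ (m + m').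
Proof.
rewrite (_ : - (_ * x) = - (s * x) + - (b * x) + - (b' * x)); last by ring.
by rewrite wtM /expmon exprD !expRD; ring.
Qed.

Lemma sqint_expmon s b m : 0 < s + 2 * b -> sqint mu D (wt s (expmon b m)).
Proof.
move=> sb; split; first by apply: measurable_wt; exact: measurable_expmon.
under eq_integral => x _.
  rewrite expr2 wt_expmonM (_ : s + b + b = s + 2 * b); last by ring.
  over.
by rewrite gamma_integral// ltry.
Qed.

Lemma ip_expmon s b b' m m' : 0 < s + b + b' ->
  ip mu D (wt s (expmon b m)) (wt s (expmon b' m')) =
  (m + m')`!%:R / (s + b + b') ^+ (m + m').+1.
Proof.
move=> sb; rewrite /ip /Rintegral.
under eq_integral do rewrite wt_expmonM.
by rewrite gamma_integral.
Qed.

Lemma Gtransform_ip s f n :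
  Gtransform s f n = n`!%:R^-1 * ip mu D (wt s f) (wt s (expmon 0 n)).
Proof.
congr (_ * _); apply: eq_Rintegral => x _.
by rewrite wtM /Gint /expmon mul0r oppr0 expR0 mul1r mulrA mulrAC.
Qed.

Definition lagfun s k : R -> R := wt s (laguerre_star k ^~ s).

Definition lagcoef s k j : R :=
  (-1) ^+ k * Num.sqrt s * ((-1) ^+ j * 'C(k, j)%:R * (s ^+ j / j`!%:R)).

Lemma lagfunE s k : lagfun s k =
  (fun x => \sum_(0 <= j < k.+1) lagcoef s k j * wt s (expmon 0 j) x).
Proof.
apply/funext => x; rewrite /lagfun /wt /laguerre_star /laguerre big_mkord.
rewrite !mulr_sumr; apply: eq_bigr => j _.
by rewrite /lagcoef /expmon mul0r oppr0 expR0 mul1r exprMn; ring.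
Qed.

Section positive_weight.
Variable s : R.
Hypothesis s0 : 0 < s.

Lemma sqint_monomial j : sqint mu D (wt s (expmon 0 j)).
Proof. by apply: sqint_expmon; rewrite mulr0 addr0. Qed.

Lemma sqint_lagfun k : sqint mu D (lagfun s k).
Proof. by rewrite lagfunE; apply: sqint_sum => //; exact: sqint_monomial. Qed.

(** The coefficients of the series defining the inverse transform are Fourier
coefficients: the explicit sum for L_k matches that for Delta^k term by term,
the factor 1/j! in L_k being the one in the transform. *)
Lemma ip_lagfun f k : sqint mu D (wt s f) ->
  ip mu D (wt s f) (lagfun s k) = Num.sqrt s * diff_coef s (Gtransform s f) k.
Proof.
move=> sf; rewrite ipC lagfunE ip_suml//; last exact: sqint_monomial.
rewrite /diff_coef iter_telescopeE mulr_sumr; apply: eq_bigr => j _.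
rewrite ipC add0n Gtransform_ip /lagcoef exprD; ring.
Qed.

(** For f = x^m the sequence s^n phi_n is a multiple of 'C(n + m, n), whose k-th
difference at 0 is 'C(m, k).  In particular the k-th function is orthogonal to
all polynomials of degree less than k. *)
Lemma ip_monomial_lagfun m k :
  ip mu D (wt s (expmon 0 m)) (lagfun s k) =
  Num.sqrt s * (m`!%:R / s ^+ m.+1 * 'C(m, k)%:R).
Proof.
rewrite ip_lagfun; last exact: sqint_monomial.
rewrite /diff_coef.
have -> : (fun n => s ^+ n * Gtransform s (expmon 0 m) n) =
    (fun n => m`!%:R / s ^+ m.+1 * 'C(n + m, n)%:R).
  apply/funext => n; rewrite Gtransform_ip ip_expmon !addr0//.
  rewrite (addnC m n); have := bin_fact (leq_addr m n); rewrite addKn => <-.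
  rewrite !natrM -addnS exprD; field.
  by rewrite !expf_neq0 ?gt_eqF// ?ltr0n ?fact_gt0.
by rewrite iter_telescopeZ iter_telescope_bin !add0n.
Qed.

Let shifted_weight_gt0 b : 0 < s + 2 * b -> 0 < s + b.
Proof.
move=> sb; rewrite (_ : s + b = (s + (s + 2 * b)) / 2); last by field.
by rewrite divr_gt0// addr_gt0.
Qed.

(** For f = e^(-bx) the sequence s^n phi_n is geometric of ratio s/(s + b);
taking the k-th difference multiplies it by (s/(s + b) - 1)^k. *)
Lemma ip_exp_lagfun b k : 0 < s + 2 * b ->
  ip mu D (wt s (expmon b 0)) (lagfun s k) =
  Num.sqrt s * ((s + b)^-1 * (s / (s + b) - 1) ^+ k).
Proof.
move=> sb; have sb0 := shifted_weight_gt0 sb.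
rewrite ip_lagfun; last exact: sqint_expmon.
rewrite /diff_coef.
have -> : (fun n => s ^+ n * Gtransform s (expmon b 0) n) =
    (fun n => (s + b)^-1 * (s / (s + b)) ^+ n).
  apply/funext => n; rewrite Gtransform_ip ip_expmon !addr0// add0n.
  rewrite exprS exprMn exprVn; field.
  by rewrite expf_neq0 ?gt_eqF// ?ltr0n ?fact_gt0.
by rewrite iter_telescopeZ iter_telescope_geometric expr0 mulr1.
Qed.

(** Take j <= k: of the monomials in the j-th polynomial only one of degree k
can fail to be orthogonal to the k-th function, so only leading terms matter. *)
Lemma lagfun_orthonormal j k :
  ip mu D (lagfun s j) (lagfun s k) = (j == k)%:R.
Proof.
wlog jk : j k / (j <= k)%N.
  by move=> h; have [/h//|/ltnW/h] := leqP j k; rewrite ipC eq_sym.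
rewrite lagfunE ip_suml//; [|exact: sqint_monomial|exact: sqint_lagfun].
under eq_bigr do rewrite ip_monomial_lagfun.
rewrite big_nat_recr//= big_nat_cond big1 ?add0r; last first.
  move=> i /andP[/andP[_ ij] _].
  by rewrite [in 'C(i, k)]bin_small ?mulr0 ?mulr0// (leq_trans ij).
move: jk; rewrite leq_eqVlt => /predU1P[<-|jk].
  rewrite eqxx /lagcoef !binn.
  have aux (e q p h : R) : p != 0 -> h != 0 -> e * e = 1 -> q * q = s ->
      e * q * (e * 1 * (p / h)) * (q * (h / (s * p) * 1)) = 1.
    move=> p0 h0 e1 qs.
    transitivity ((e * e) * (q * q) / s); first by field; rewrite p0 h0 lt0r_neq0.
    by rewrite e1 qs mul1r divff// lt0r_neq0.
  rewrite exprS aux ?expf_neq0 ?lt0r_neq0 ?ltr0n ?fact_gt0//.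
    by rewrite -exprMn mulrNN mulr1 expr1n.
  by rewrite -expr2 sqr_sqrtr// ltW.
by rewrite (ltn_eqF jk) [in 'C(j, k)]bin_small// !mulr0.
Qed.

(** By Pythagoras it suffices that the squared coefficients add up to the
squared norm 1/(s + 2b).  They form a geometric series of ratio q = (b/(s + b))^2, and
1 - q = s(s + 2b)/(s + b)^2; in particular q < 1 exactly because s + 2b > 0. *)
Lemma expandable_exp b : 0 < s + 2 * b ->
  expandable mu D (lagfun s) (wt s (expmon b 0)).
Proof.
move=> sb; have sb0 := shifted_weight_gt0 sb.
pose q := (s / (s + b) - 1) ^+ 2.
have q1 : 1 - q = s * (s + 2 * b) / (s + b) ^+ 2.
  by rewrite /q; field; exact: lt0r_neq0.
have q01 : `|q| < 1.
  rewrite ger0_norm ?sqr_ge0// -subr_gt0 q1.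
  by rewrite divr_gt0 ?exprn_gt0 ?mulr_gt0.
pose a := s / (s + b) ^+ 2.
have pyth n : ip mu D (fourier_rest mu D (lagfun s) (wt s (expmon b 0)) n)
    (fourier_rest mu D (lagfun s) (wt s (expmon b 0)) n) =
    (s + 2 * b)^-1 - series (geometric a q) n.
  rewrite (@pythagoras _ _ _ mu D mD); last 3 first.
  - exact: sqint_lagfun.
  - exact: lagfun_orthonormal.
  - exact: sqint_expmon.
  rewrite ip_expmon; last by lra.
  congr (_ - _).
    by rewrite fact0 expr1 mul1r; congr (_^-1); ring.
  rewrite /series/=; apply: eq_bigr => k _; rewrite ip_exp_lagfun//.
  rewrite exprMn sqr_sqrtr ?ltW// exprMn -exprM mulnC exprM mulrA.
  by congr (_ * _); rewrite exprVn.
rewrite /expandable (funext pyth).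
have <- : (s + 2 * b)^-1 - a * (1 - q)^-1 = 0.
  by rewrite q1 /a; field; rewrite !gt_eqF.
apply: cvgB; first exact: cvg_cst.
exact: cvg_geometric_series.
Qed.

End positive_weight.
End laguerre_functions.

(** * Recovering a sequence from the sum of its Laguerre series *)

Section inversion.
Context {R : realType}.
Local Notation mu := (@lebesgue_measure R).
Local Notation D := (`]0%R, +oo[%classic : set R).
Implicit Types (s b x : R) (f g : R -> R) (phi : R^nat).

Let mD : measurable D := measurable_itv _.

Lemma wtB s f g :
  wt s (fun x => f x - g x) = (fun x => wt s f x - wt s g x).
Proof. by apply/funext => x; rewrite /wt mulrBr. Qed.

Lemma wt_Rpartial s phi K : wt s (Rpartial s phi K) =
  (fun x => \sum_(0 <= k < K) (diff_coef s phi k * Num.sqrt s) * lagfun s k x).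
Proof.
apply/funext => x; rewrite /wt /Rpartial mulr_sumr.
by apply: eq_bigr => k _; rewrite /lagfun /wt mulrCA.
Qed.

Variable s : R.
Hypothesis s0 : 0 < s.

Lemma sqint_Rpartial phi K : sqint mu D (wt s (Rpartial s phi K)).
Proof. by rewrite wt_Rpartial; apply: sqint_sum => //; exact: sqint_lagfun. Qed.

Lemma sqnormL2_rest phi f K : sqint mu D (wt s f) ->
  sqnormL2 s (fun x => f x - Rpartial s phi K x) =
  (ip mu D (fun x => wt s f x - wt s (Rpartial s phi K) x)
           (fun x => wt s f x - wt s (Rpartial s phi K) x))%:E.
Proof.
move=> sf; rewrite sqnormL2E wtB integral_sqrE//.
by apply: sqintB => //; exact: sqint_Rpartial.
Qed.

(** The terms of the partial sum with k > n do not contribute, and Newton's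
formula sums the others; hence the moments of the partial sums stabilize. *)
Lemma ip_Rpartial_monomial phi n K : (n < K)%N ->
  ip mu D (wt s (Rpartial s phi K)) (wt s (expmon 0 n)) = n`!%:R * phi n.
Proof.
move=> nK; rewrite wt_Rpartial ip_suml//; last 2 first.
- exact: sqint_lagfun.
- exact: sqint_monomial.
have sn : s ^+ n != 0 by rewrite expf_neq0 ?lt0r_neq0.
rewrite -[phi n](mulKf sn) -(newton_forward (fun n => s ^+ n * phi n) nK).
rewrite !mulr_sumr; apply: eq_bigr => k _.
rewrite ipC ip_monomial_lagfun// /diff_coef.
rewrite [LHS](_ : _ = (Num.sqrt s * Num.sqrt s) * (n`!%:R / s ^+ n.+1) *
  ('C(n, k)%:R * iter k telescope (fun n => s ^+ n * phi n) 0%N)); last by ring.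
rewrite -expr2 sqr_sqrtr ?ltW// exprS; field.
by rewrite sn lt0r_neq0.
Qed.

Lemma Rtransform_exists phi : Sc s phi -> exists f, is_Rtransform s phi f.
Proof.
move=> Sphi.
pose u K := wt s (Rpartial s phi K).
have su K : sqint mu D (u K) by exact: sqint_Rpartial.
pose Q := series (fun k => diff_coef s phi k ^+ 2).
have dist n m : (n <= m)%N ->
    ip mu D (fun x => u m x - u n x) (fun x => u m x - u n x) = s * (Q m - Q n).
  move=> nm.
  have -> : (fun x => u m x - u n x) = (fun x =>
      \sum_(n <= k < m) (diff_coef s phi k * Num.sqrt s) * lagfun s k x).
    apply/funext => x; rewrite /u !wt_Rpartial (big_cat_nat (leq0n n) nm)//=.
    by rewrite addrAC subrr add0r.
  rewrite ip_sum_orthonormal//; last 2 first.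
  - exact: sqint_lagfun.
  - exact: lagfun_orthonormal.
  rewrite /Q /series/= (big_cat_nat (leq0n n) nm)//= addrAC subrr add0r mulr_sumr.
  by apply: eq_bigr => k _; rewrite exprMn sqr_sqrtr ?ltW// mulrC.
have distC n m : ip mu D (fun x => u m x - u n x) (fun x => u m x - u n x) =
    ip mu D (fun x => u n x - u m x) (fun x => u n x - u m x).
  by apply: eq_Rintegral => x _; rewrite -[X in X * _]opprB -[X in _ * X]opprB mulrNN.
have [|F sF FL] := @riesz_fischer _ _ _ mu D mD u su.
  move=> eps eps0.
  have /cvgrPdist_lt/(_ (eps / (2 * s)))[|N _ HN] := Sphi.
    by rewrite divr_gt0// mulr_gt0.
  exists N.
  suff H m n : (N <= n)%N -> (n <= m)%N ->
      ip mu D (fun x => u m x - u n x) (fun x => u m x - u n x) <= eps.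
    move=> m n Nm Nn; have [mn|/ltnW nm] := leqP m n; last exact: H.
    by rewrite distC; exact: H.
  move=> Nn nm; rewrite dist//.
  have h1 := HN n Nn; have h2 := HN m (leq_trans Nn nm).
  have : `|Q m - Q n| < eps / s.
    rewrite (_ : Q m - Q n = (limn Q - Q n) - (limn Q - Q m)); last by ring.
    apply: le_lt_trans (ler_normB _ _) _; apply: lt_le_trans (ltrD h1 h2) _.
    by rewrite le_eqVlt; apply/orP; left; apply/eqP; field; exact: lt0r_neq0.
  move=> h; have : Q m - Q n <= eps / s by apply: le_trans (ler_norm _) (ltW h).
  by rewrite ler_pdivlMr// mulrC.
pose f := wt (- s) F.
have wf : wt s f = F by exact: wtK.
exists f; split => //; first by apply/inL2E; rewrite wf.
rewrite (_ : (fun K => _) = EFin \o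
  (fun n => ip mu D (fun x => F x - u n x) (fun x => F x - u n x))).
  by apply: cvg_EFin => //; exact: nearW.
by apply/funext => K /=; rewrite sqnormL2_rest wf.
Qed.

(** The n-th moment is a continuous linear functional, the monomials being
square integrable for the weight, so it can be computed on the partial sums. *)
Lemma GtransformK phi f : is_Rtransform s phi f -> forall n,
  mu.-integrable D (EFin \o Gint s f n) /\ Gtransform s f n = phi n.
Proof.
move=> [Sphi /inL2E sF rest] n.
have sM := sqint_monomial s0 n.
split.
  have := @sqint_integrable _ _ _ mu D mD _ _ sF sM; congr integrable.
  apply/funext => x /=; congr EFin.
  by rewrite wtM /Gint /expmon mul0r oppr0 expR0 mul1r mulrA mulrAC.
rewrite Gtransform_ip; apply: (@mulfI _ n`!%:R).
  by rewrite pnatr_eq0 -lt0n fact_gt0.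
rewrite mulrA divff ?mul1r ?pnatr_eq0 -?lt0n ?fact_gt0//.
pose r K := fun x => wt s f x - wt s (Rpartial s phi K) x.
have sr K : sqint mu D (r K) by apply: sqintB => //; exact: sqint_Rpartial.
have rest0 : ip mu D (r K) (r K) @[K --> \oo] --> (0 : R).
  have /fine_cvgP[_] := rest.
  rewrite (_ : fine \o _ = fun K => ip mu D (r K) (r K))//.
  by apply/funext => K /=; rewrite sqnormL2_rest.
set a := ip mu D _ _; apply/eqP; rewrite -subr_eq0 -sqrf_eq0.
apply/eqP/le_anti/andP; split; last exact: sqr_ge0.
have bound K : (n < K)%N ->
    (a - n`!%:R * phi n) ^+ 2 <= ip mu D (r K) (r K) *
      ip mu D (wt s (expmon 0 n)) (wt s (expmon 0 n)).
  move=> nK; rewrite -(ip_Rpartial_monomial phi nK) /a -ipBl//.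
    exact: (@cauchy_schwarz _ _ _ mu D mD (r K) _ (sr K) sM).
  exact: sqint_Rpartial.
move: bound; set B := ip mu D (wt s (expmon 0 n)) _ => bound.
have lim0 : ip mu D (r K) (r K) * B @[K --> \oo] --> 0 * B.
  by apply: cvgMr_tmp; exact: rest0.
rewrite mul0r in lim0.
rewrite -(cvg_lim (@Rhausdorff R) lim0).
apply: limr_ge; first by apply/cvg_ex; eexists; exact: lim0.
near=> K; apply: bound; near: K; exact: nbhs_infty_gt.
Unshelve. all: by end_near. Qed.

End inversion.

(** * Laguerre expansion of functions of exponential order *)

Section expansion.
Context {R : realType}.
Local Notation mu := (@lebesgue_measure R).
Local Notation D := (`]0%R, +oo[%classic : set R).
Implicit Types (s r x M : R) (f g : R -> R).

Let mD : measurable D := measurable_itv _.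

Definition discontinuities f : set R :=
  [set x | 0 < x /\ ~ {for x, continuous f}].

(** The intervals [1/(n + 1), n + 1] exhaust (0, oo), and each contains finitely
many discontinuities. *)
Lemma countable_discontinuities f :
  piecewise_continuous f -> countable (discontinuities f).
Proof.
move=> [fin _].
pose I n := [set x | n.+1%:R^-1 <= x <= n.+1%:R /\ ~ {for x, continuous f}].
apply: (@sub_countable _ _ _ (\bigcup_n I n)); last first.
  apply: bigcup_countable => // n _; apply: finite_set_countable.
  by apply: fin; rewrite invr_gt0.
apply: subset_card_le => x [x0 xd].
exists (maxn (Num.bound x) (Num.bound x^-1)) => //; split => //.
have le_bound (y : R) (m : nat) : 0 < y -> (Num.bound y <= m)%N -> y <= m.+1%:R.
  move=> y0 ym; apply/ltW/(lt_le_trans (archi_boundP (ltW y0))).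
  by rewrite ler_nat; exact: leqW.
rewrite le_bound ?leq_maxl// andbT.
rewrite -[leRHS]invrK lef_pV2 ?posrE ?invr_gt0//.
by rewrite le_bound ?invr_gt0// leq_maxr.
Qed.

(** Every subset of the countable set of discontinuities is a Borel set, so f is
measurable there whatever its values; elsewhere f is a limit of measurable
functions. *)
Lemma measurable_fun_piecewise_continuous_cvg f (g : nat -> R -> R) :
  piecewise_continuous f -> (forall n, measurable_fun D (g n)) ->
  (forall x, 0 < x -> {for x, continuous f} -> g ^~ x @ \oo --> f x) ->
  measurable_fun D f.
Proof.
move=> pf mg gf.
have cN := countable_discontinuities pf.
have mcount (A : set R) : countable A -> measurable A.
  by move=> cA; apply: countable_measurable => //; exact: measurable_set1.
have mN := mcount _ cN.
have -> : D = discontinuities f `|` (D `\` discontinuities f).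
  rewrite setDUK//; move=> x [x0 _] /=; by rewrite in_itv/= x0.
apply/measurable_funU => //; first exact: measurableD.
split.
  move=> _ Y _; apply: mcount; apply: sub_countable cN.
  by apply: subset_card_le => x [].
apply: (@measurable_fun_cvg _ _ _ _ g).
  by move=> n; exact: measurable_funS (mg n).
move=> x [/=]; rewrite in_itv/= andbT => x0 xN.
by apply: gf => //; apply: contrapT => xd; exact: xN.
Qed.

Section approximants.
Variables (r M : R) (f : R -> R).
Hypothesis fM : forall t, 0 < t -> `|f t| < M * expR (r * t).

(** The bounded function e^(-rx) f(x) in the variable v = e^(-x).  The Bernstein
operator also evaluates it at the end points 0 and 1, which correspond to no
x > 0; the value 0 there keeps it bounded. *)
Definition damped (v : R) : R :=
  if 0 < v < 1 then expR (r * ln v) * f (- ln v) else 0.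

Lemma damped_expN x : 0 < x -> damped (expR (- x)) = expR (- (r * x)) * f x.
Proof.
move=> x0; rewrite /damped expR_gt0 expR_lt1 oppr_lt0 x0/= expRK opprK.
by rewrite mulrN.
Qed.

Lemma norm_damped_le v : `|damped v| <= M.
Proof.
have M0 : 0 < M.
  have := le_lt_trans (normr_ge0 _) (fM ltr01).
  by rewrite pmulr_lgt0// expR_gt0.
rewrite /damped; case: ifPn => [/andP[v0 v1]|_]; last by rewrite normr0 ltW.
have lv : 0 < - ln v by rewrite oppr_gt0 ln_lt0// v0.
rewrite normrM ger0_norm ?expR_ge0//.
apply: le_trans (ler_wpM2l (expR_ge0 _) (ltW (fM lv))) _.
by rewrite mulrCA -expRD mulrN subrr expR0 mulr1.
Qed.

Lemma continuous_damped x : 0 < x -> {for x, continuous f} ->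
  {for expR (- x), continuous damped}.
Proof.
move=> x0 cf; set u := expR (- x).
have u0 : 0 < u by exact: expR_gt0.
have u1 : u < 1 by rewrite /u expR_lt1 oppr_lt0.
have lnu : - ln u = x by rewrite /u expRK opprK.
pose h v := expR (r * ln v) * f (- ln v).
have hu : h u = damped u by rewrite /damped u0 u1.
have ch : h v @[v --> u] --> h u.
  have cln : - ln v @[v --> u] --> - ln u by apply: cvgN; exact: continuous_ln.
  apply: cvgM.
    apply: (@cvg_comp _ _ _ (fun v => r * ln v) expR _ (nbhs (r * ln u))).
      by apply: cvgMl_tmp; exact: continuous_ln.
    exact: continuous_expR.
  apply: (@cvg_comp _ _ _ (fun v => - ln v) f _ (nbhs (- ln u))) => //.
  by rewrite lnu; exact: cf.
rewrite /prop_for /continuous_at -hu.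
apply: cvg_trans ch; apply: near_eq_cvg; near=> v.
rewrite /h /damped ifT//; apply/andP; split; near: v.
- exact: lt_nbhsr.
- exact: lt_nbhsl.
Unshelve. all: by end_near. Qed.

Definition approximant n x : R :=
  expR (r * x) * bernstein n.+1 (fun k => damped (k%:R / n.+1%:R)) (expR (- x)).

(** The Bernstein operator yields a polynomial in e^(-x), whence exponentials of
rates j - r with j >= 0. *)
Lemma approximantE n : exists (c : R^nat) K, approximant n =
  (fun x => \sum_(0 <= j < K) c j * expmon (j%:R - r) 0 x).
Proof.
have [p hp] := bernstein_horner n.+1 (fun k => damped (k%:R / n.+1%:R)).
exists (fun j => p`_j), (size p); apply/funext => x.
rewrite /approximant hp horner_coef big_mkord mulr_sumr.
apply: eq_bigr => j _; rewrite /expmon expr0 mulr1 mulrCA -expRM_natl -expRD.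
by congr (_ * expR _); ring.
Qed.

Lemma approximant_cvg x : 0 < x -> {for x, continuous f} ->
  approximant ^~ x @ \oo --> f x.
Proof.
move=> x0 cf.
have -> : f x = expR (r * x) * damped (expR (- x)).
  by rewrite damped_expN// mulrA -expRD subrr expR0 mul1r.
apply: cvgMl_tmp; apply: (bernstein_cvg (M := M)).
- by rewrite expR_ge0 expR_le1 oppr_le0 ltW.
- exact: norm_damped_le.
- exact: continuous_damped.
Qed.

Lemma norm_approximant_le n x : 0 < x -> `|approximant n x| <= M * expR (r * x).
Proof.
move=> x0; rewrite /approximant normrM ger0_norm ?expR_ge0// mulrC.
rewrite ler_wpM2r ?expR_ge0// bernstein_norm_le//.
- by rewrite expR_ge0 expR_le1 oppr_le0 ltW.
- by move=> k; exact: norm_damped_le.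
Qed.

Variable s : R.
Hypotheses (r0 : 0 < r) (rs : 2 * r < s).

Let s0 : 0 < s.
Proof. by apply: lt_trans rs; rewrite mulr_gt0. Qed.

Let exp_admissible j : 0 < s + 2 * (j%:R - r).
Proof.
by rewrite mulrBr addrCA ltr_wpDl// ?subr_gt0// mulr_ge0.
Qed.

Lemma wt_approximant n : exists (c : R^nat) K, wt s (approximant n) =
  (fun x => \sum_(0 <= j < K) c j * wt s (expmon (j%:R - r) 0) x).
Proof.
have [c [K ->]] := approximantE n; exists c, K; apply/funext => x.
by rewrite /wt mulr_sumr; apply: eq_bigr => j _; rewrite mulrCA.
Qed.

Lemma sqint_approximant n : sqint mu D (wt s (approximant n)).
Proof.
have [c [K ->]] := wt_approximant n.
by apply: sqint_sum => // j; exact: sqint_expmon.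
Qed.

Lemma expandable_approximant n :
  expandable mu D (lagfun s) (wt s (approximant n)).
Proof.
have [c [K ->]] := wt_approximant n.
apply: expandable_sum => //.
- exact: sqint_lagfun.
- by move=> j; exact: sqint_expmon.
- by move=> j; exact: expandable_exp.
Qed.

Lemma wt_sqr_le (g : R -> R) C x : 0 <= C -> `|g x| <= C * expR (r * x) ->
  wt s g x ^+ 2 <= C ^+ 2 * (expR (- ((s - 2 * r) * x)) * x ^+ 0).
Proof.
move=> C0 gC; rewrite expr2 wtM expr0 mulr1 -expr2.
rewrite (_ : - ((s - 2 * r) * x) = - (s * x) + (r * x + r * x)); last by ring.
rewrite !expRD [leRHS]mulrCA; apply: ler_wpM2l; first exact: expR_ge0.
rewrite -expr2 -exprMn.
rewrite -(real_normK (num_real (g x))) lerXn2r ?nnegrE//.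
by rewrite mulr_ge0 ?expR_ge0.
Qed.

Lemma integrable_majorant C : mu.-integrable D
  (fun x => (C * (expR (- ((s - 2 * r) * x)) * x ^+ 0))%:E).
Proof.
have sr : 0 < s - 2 * r by rewrite subr_gt0.
suff h : mu.-integrable D
    (fun x => (expR (- ((s - 2 * r) * x)) * x ^+ 0)%:E).
  exact: (@integrableZl _ _ _ mu D mD C _ h).
apply/integrableP; split.
  by apply/measurable_EFinP; exact: (measurable_expmon (s - 2 * r) 0).
under eq_integral => x.
  rewrite inE/= in_itv/= andbT => x0.
  rewrite ger0_norm ?mulr_ge0 ?expR_ge0 ?exprn_ge0 ?ltW//.
  over.
by rewrite gamma_integral// ltry.
Qed.

Hypothesis pf : piecewise_continuous f.

Let M0 : 0 <= M.
Proof. exact: le_trans (norm_damped_le 0). Qed.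

Lemma sqint_exponential_order : sqint mu D (wt s f).
Proof.
have mf : measurable_fun D f.
  apply: (measurable_fun_piecewise_continuous_cvg pf _ approximant_cvg) => n.
  by have [] := (inL2E s (approximant n)).2 (sqint_approximant n).
have mwf : measurable_fun D (wt s f) by exact: measurable_wt.
split => //.
have mj := integrable_majorant (M ^+ 2).
have /(le_lt_trans _) := @integrable_lty _ _ _ mu D mD _ mj; apply.
apply: ge0_le_integral => //.
- by move=> x _; rewrite lee_fin sqr_ge0.
- by apply/measurable_EFinP/measurable_funX.
- by case/integrableP : mj.
- move=> x /=; rewrite in_itv/= andbT => x0.
  by rewrite lee_fin wt_sqr_le// ltW// fM.
Qed.

Lemma approximant_cvgL2 :
  ip mu D (fun x => wt s f x - wt s (approximant n) x)
          (fun x => wt s f x - wt s (approximant n) x) @[n --> \oo] --> (0 : R).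
Proof.
have sf := sqint_exponential_order.
have sd n : sqint mu D (fun x => wt s f x - wt s (approximant n) x).
  by apply: sqintB => //; exact: sqint_approximant.
pose d n x := ((wt s f x - wt s (approximant n) x) ^+ 2)%:E.
have mN : mu.-negligible (discontinuities f).
  have cN := countable_discontinuities pf.
  apply/negligibleP; last exact: countable_lebesgue_measure0.
  by apply: countable_measurable => //; exact: measurable_set1.
have d0 : {ae mu, forall x, D x -> d ^~ x @ \oo --> 0%E}.
  apply: negligibleS mN => x /=; apply: contra_notP => /not_andP xN.
  rewrite in_itv/= andbT => x0.
  have cx : {for x, continuous f}.
    by case: xN => [//|cf]; exact: contrapT.
  apply: cvg_EFin; first exact: nearW.
  have h : wt s f x - wt s (approximant n) x @[n --> \oo] --> (0 : R).
    rewrite -(subrr (wt s f x)); apply: cvgB; first exact: cvg_cst.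
    by apply: cvgMl_tmp; exact: approximant_cvg.
  rewrite -(mulr0 (0 : R)); exact: (cvgM h h).
have dle : {ae mu, forall x n, D x -> (`|d n x| <=
    ((2 * M) ^+ 2 * (expR (- ((s - 2 * r) * x)) * x ^+ 0))%:E)%E}.
  apply: aeW => x n; rewrite /= in_itv/= andbT => x0.
  rewrite ger0_norm ?sqr_ge0// lee_fin.
  have <- : wt s (fun x => f x - approximant n x) x =
      wt s f x - wt s (approximant n) x by rewrite wtB.
  apply: wt_sqr_le; first by rewrite mulr_ge0.
  apply: le_trans (ler_normB _ _) _; rewrite -mulrA mulr_natl mulr2n.
  by apply: lerD; [exact/ltW/fM|exact: norm_approximant_le].
have md n : measurable_fun D (d n).
  by apply/measurable_EFinP/measurable_funX; case: (sd n).
have [_ _] := @dominated_convergence _ _ _ mu D mD d (fun=> 0%E) _ md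
  (measurable_cst _) d0 (integrable_majorant _) dle.
rewrite integral0 => /fine_cvgP[_].
rewrite (_ : fine \o _ = fun n => ip mu D
  (fun x => wt s f x - wt s (approximant n) x)
  (fun x => wt s f x - wt s (approximant n) x))//.
Qed.

(** The approximants are expandable and converge to f in the mean. *)
Lemma expandable_exponential_order : expandable mu D (lagfun s) (wt s f).
Proof.
apply: expandable_limit => //.
- exact: sqint_lagfun.
- exact: lagfun_orthonormal.
- exact: sqint_exponential_order.
move=> eps eps0.
have /cvgrPdist_lt/(_ _ eps0)[n _ /(_ n (leqnn n))] := approximant_cvgL2.
rewrite sub0r normrN ger0_norm ?ip_ge0// => dn.
exists (wt s (approximant n)); split => //.
- exact: sqint_approximant.
- exact: expandable_approximant.
Qed.

(** Square summability of the coefficients is Bessel's inequality; the rest is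
the expandability of f. *)
Lemma Rtransform_Gtransform : is_Rtransform s (Gtransform s f) f.
Proof.
have sf := sqint_exponential_order.
have coefE k : diff_coef s (Gtransform s f) k * Num.sqrt s =
    ip mu D (wt s f) (lagfun s k) by rewrite ip_lagfun// mulrC.
have restE K : (fun x => wt s f x - wt s (Rpartial s (Gtransform s f) K) x) =
    fourier_rest mu D (lagfun s) (wt s f) K.
  apply/funext => x; rewrite wt_Rpartial /fourier_rest; congr (_ - _).
  by apply: eq_bigr => k _; rewrite coefE.
split.
- apply: nondecreasing_is_cvgn.
    by apply: nondecreasing_series => k _ _; exact: sqr_ge0.
  exists (ip mu D (wt s f) (wt s f) / s) => _ [n _ <-].
  rewrite ler_pdivlMr// /series/= mulr_suml.
  rewrite (eq_bigr (fun k => ip mu D (wt s f) (lagfun s k) ^+ 2)).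
    apply: bessel => //; first exact: sqint_lagfun.
    exact: lagfun_orthonormal.
  by move=> k _; rewrite -coefE exprMn sqr_sqrtr// ltW.
- exact/inL2E.
- rewrite (_ : (fun K => _) = EFin \o (fun K => ip mu D
    (fourier_rest mu D (lagfun s) (wt s f) K)
    (fourier_rest mu D (lagfun s) (wt s f) K))).
    by apply: cvg_EFin; [exact: nearW|exact: expandable_exponential_order].
  by apply/funext => K /=; rewrite sqnormL2_rest// restE.
Qed.

End approximants.
End expansion.

(** * The two transforms are mutually inverse *)

Theorem theorem2 (R : realType) :
  (forall (r s : R) (f : R -> R),
     0 < r -> 2 * r < s ->
     piecewise_continuous f -> exponential_order r f ->
     is_Rtransform s (Gtransform s f) f)
  /\
  (forall (s : R) (phi : R^nat),
     0 < s -> Sc s phi ->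
     (exists f : R -> R, is_Rtransform s phi f) /\
     (forall f : R -> R, is_Rtransform s phi f ->
        forall n : nat,
          (@lebesgue_measure R).-integrable `]0, +oo[ (EFin \o Gint s f n) /\
          Gtransform s f n = phi n)).
Proof.
split=> [r s f r0 rs pf [M _ fM]|s phi s0 Sphi].
  exact: (Rtransform_Gtransform fM).
split; first exact: Rtransform_exists.
by move=> f; exact: GtransformK.
Qed.
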